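(* Let $p\ge4$ be even, let $\eta_p^*$ and $\eta_{\rm OGP,p}$ be as described in the context, let $\alpha>0$ and let $\rho$ be a constant with $\eta_{\rm OGP,p}/\eta_p^*<\rho<1$. Let $s(n),d(n)$ be positive-integer-valued sequences. Then for all sufficiently large $n$, either the family $\mathcal{C}_p(n,s(n),d(n),\rho)$ is empty, or $s(n)\ge n^\alpha$, or $d(n)\ge \log n/(2\log\log n)$.
   Context: A $p$-tensor is $J\in\{\pm1\}^{n^p}$ indexed by $(i_1,\dots,i_p)\in[n]^p$; for $\sigma\in\{\pm1\}^n$, $\langle J,\sigma\rangle=\sum_{i_1,\dots,i_p}J_{i_1,\dots,i_p}\sigma_{i_1}\cdots\sigma_{i_p}$. For $J$ with i.i.d. Rademacher (uniform $\pm1$) entries, $\eta^*_{n,p}=n^{-\frac{p+1}{2}}\max_{\sigma}\langle J,\sigma\rangle$, and $\eta^*_p>0$ is the known constant with $\mathbb{P}(|\eta^*_{n,p}-\eta^*_p|\ge\epsilon)\le e^{-\gamma' n}$ for each $\epsilon>0$, some $\gamma'>0$ and all large $n$. Interpolation path: $J_0=J$ i.i.d. Rademacher; $I_1,\dots,I_{n^p}$ a uniformly random ordering of $[n]^p$ independent of $J$; $J_t$ is obtained from $J_{t-1}$ by resampling the entry $I_t$ with an independent Rademacher variable. The constants $0<\eta_{\rm OGP,p}<\eta^*_p$, $0<\nu_{1,p}<\nu_{2,p}<1$, $\gamma>0$ are fixed constants for which the ensemble overlap gap property holds: for all large $n$, with probability $\ge 1-e^{-\gamma n}$, (a) for all $0\le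 t_1\le t_2\le n^p$ and $\sigma_1,\sigma_2\in\{\pm1\}^n$ with $\langle J_{t_j},\sigma_j\rangle\ge\eta_{\rm OGP,p}n^{\frac{p+1}{2}}$ ($j=1,2$), $|\langle\sigma_1,\sigma_2\rangle|/n\notin(\nu_{1,p},\nu_{2,p})$, and (b) if moreover $t_1=0,t_2=n^p$ then $|\langle\sigma_1,\sigma_2\rangle|/n\le\nu_{1,p}$ (such constants exist for every even $p\ge 4$). Boolean circuits: directed acyclic graphs with $n^p$ input nodes, $n$ output nodes and internal gates computing $\vee,\wedge,\neg$ (with values encoded as $\pm1$), thus computing a map $C:\{\pm1\}^{n^p}\to\{\pm1\}^n$; size is the number of gates and depth the length of the longest directed path. $\mathcal{C}_p(n,s(n),d(n),\rho)$ is the family of all such circuits $C$ with size at most $s(n)$, depth at most $d(n)$, and such that for every $J\in\{\pm1\}^{n^p}$ with $\max_{\sigma}\langle J,\sigma\rangle\ge0$ one has $\langle J,C(J)\rangle\ge\rho\max_{\sigma\in\{\pm1\}^n}\langle J,\sigma\rangle$ (no requirement when the maximum is negative). *)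

(* Defs.v *)
From HB Require Import structures.
From mathcomp Require Import all_boot all_order all_algebra.
From mathcomp Require Import all_classical all_reals all_analysis.
Set Implicit Arguments.
Unset Strict Implicit.
Unset Printing Implicit Defensive.
Import Order.TTheory GRing.Theory Num.Theory.
Local Open Scope ring_scope.
Local Open Scope classical_set_scope.

(* Booleans stand for signs: [true] is +1 and [false] is -1. *)
Definition sgn (R : realType) (b : bool) : R := if b then 1 else -1.

Definition spins (n : nat) := {ffun 'I_n -> bool}.
Definition multi_index (p n : nat) := {ffun 'I_p -> 'I_n}.
Definition tensor (p n : nat) := {ffun multi_index p n -> bool}.

Definition energy (R : realType) (p n : nat) (J : tensor p n) (s : spins n) : R :=
  \sum_(i : multi_index p n) sgn R (J i) * \prod_(k < p) sgn R (s (i k)).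

(* The neutral value is itself one of the values maximized over. *)
Definition max_energy (R : realType) (p n : nat) (J : tensor p n) : R :=
  \big[Num.max/energy R J [ffun=> true]]_(s : spins n) energy R J s.

Definition overlap (R : realType) (n : nat) (s1 s2 : spins n) : R :=
  \sum_(i < n) sgn R (s1 i) * sgn R (s2 i).

Definition scale (R : realType) (p n : nat) : R :=
  n%:R `^ (p.+1%:R / 2).

Definition eta_n (R : realType) (p n : nat) (J : tensor p n) : R :=
  (scale R p n)^-1 * max_energy R J.

Definition Pr (R : realType) (T : finType) (E : T -> Prop) : R :=
  #|[pred x : T | `[< E x >]]|%:R / #|T|%:R.

Definition is_eta_star (R : realType) (p : nat) (eta : R) : Prop :=
  0 < eta /\
  forall eps : R, 0 < eps -> exists2 g : R, 0 < g &
    \forall n \near \oo,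
      Pr R (fun J : tensor p n => eps <= `|eta_n R J - eta|) <= expR (- g * n%:R).

(* A repetition-free tuple of n ^ p indices is an ordering of all of them. *)
Definition ordering (p n : nat) := {r : (n ^ p).-tuple (multi_index p n) | uniq r}.

(* The initial tensor, the ordering, and the fresh signs; the uniform law on
   this product makes the three parts independent and all signs Rademacher. *)
Definition path_space (p n : nat) : finType :=
  (tensor p n * ordering p n * (n ^ p).-tuple bool)%type.

Definition resample (p n : nat) (J : tensor p n) (ib : multi_index p n * bool)
  : tensor p n := [ffun i => if i == ib.1 then ib.2 else J i].

Definition interp (p n : nat) (w : path_space p n) (t : nat) : tensor p n :=
  let: (J, ord, X) := w in foldl (@resample p n) J (take t (zip (val ord) X)).

Definition ogp_event (R : realType) (p n : nat) (eta nu1 nu2 : R)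
    (w : path_space p n) : Prop :=
  forall (t1 t2 : nat) (s1 s2 : spins n),
    (t1 <= t2)%N -> (t2 <= n ^ p)%N ->
    eta * scale R p n <= energy R (interp w t1) s1 ->
    eta * scale R p n <= energy R (interp w t2) s2 ->
    let q := `|overlap R s1 s2| / n%:R in
    ~ (nu1 < q < nu2) /\ (t1 = 0%N -> t2 = (n ^ p)%N -> q <= nu1).

Definition ensemble_OGP (R : realType) (p : nat) (eta nu1 nu2 g : R) : Prop :=
  \forall n \near \oo,
    1 - expR (- g * n%:R) <= Pr R (@ogp_event R p n eta nu1 nu2).

Inductive gate_op := And | Or | Not.

Definition edge (I G : finType) (wire : I + G -> G -> bool) : rel (I + G) :=
  fun u v => if v is inr g then wire u g else false.

(* The nodes are the inputs [I] and the gates; [wire u g] is an edge from the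
   node [u] into the gate [g].  The fan-in of [And] and [Or] is unbounded, and
   [output] designates the output nodes among the inputs and the gates. *)
Record circuit (I O : finType) := Circuit {
  gate : finType;
  op : gate -> gate_op;
  wire : I + gate -> gate -> bool;
  output : O -> I + gate;
  acyclic : forall c : seq (I + gate), cycle (edge wire) c -> c = [::];
  not_fanin : forall g, op g = Not -> #|[pred u | wire u g]| = 1%N
}.

Definition node (I O : finType) (C : circuit I O) : finType := (I + gate C)%type.

Definition csize (I O : finType) (C : circuit I O) : nat := #|gate C|.

(* In an acyclic graph a directed path has fewer edges than there are nodes. *)
Definition cdepth (I O : finType) (C : circuit I O) : nat :=
  \max_(k < #|node C| | [exists u : node C, exists q : k.-tuple (node C),
                            path (edge (@wire _ _ C)) u q]) k.

Definition update (I O : finType) (C : circuit I O) (x : {ffun I -> bool})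
    (v : node C -> bool) (u : node C) : bool :=
  match u with
  | inl i => x i
  | inr g => match op g with
             | And => [forall w, wire w g ==> v w]
             | Or  => [exists w, wire w g && v w]
             | Not => [exists w, wire w g && ~~ v w]
             end
  end.

(* By acyclicity, #|node C| rounds of updating reach an assignment of values
   to the nodes that is consistent at every gate: see [node_valueE]. *)
Definition node_value (I O : finType) (C : circuit I O) (x : {ffun I -> bool})
  : node C -> bool := iter #|node C| (@update _ _ C x) (fun=> false).

Definition ceval (I O : finType) (C : circuit I O) (x : {ffun I -> bool})
  : {ffun O -> bool} := [ffun o => node_value x (output C o)].

Lemma circuit_path_uniq (I O : finType) (C : circuit I O) (u : node C)
    (q : seq (node C)) : path (edge (@wire _ _ C)) u q -> uniq (u :: q).
Proof.
elim: q u => [//|v q IHq] u uvq.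
have /= vq : path (edge (@wire _ _ C)) v q by case/andP: uvq.
apply/andP; split; last exact: IHq vq.
apply/negP => uin; case/splitPr: uin uvq => q1 q2.
rewrite -cat_rcons cat_path => /andP[uq _].
by have := @acyclic _ _ C (u :: q1) uq.
Qed.

Lemma circuit_path_size (I O : finType) (C : circuit I O) (u : node C)
    (q : seq (node C)) :
  path (edge (@wire _ _ C)) u q -> (size q < #|node C|)%N.
Proof.
by move=> /circuit_path_uniq/card_uniqP /= <-; exact: max_card.
Qed.

Lemma cdepth_leP (I O : finType) (C : circuit I O) (d : nat) :
  (cdepth C <= d)%N <->
  (forall (u : node C) q, path (edge (@wire _ _ C)) u q -> (size q <= d)%N).
Proof.
split=> [Cd u q uq | Cd].
  apply: leq_trans Cd.
  apply: (@bigop.bigmax_sup _ (Ordinal (circuit_path_size uq)) _ _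
            (@nat_of_ord #|node C|)) => //=.
  by apply/existsP; exists u; apply/existsP; exists (in_tuple q).
apply/bigop.bigmax_leqP => k /existsP[u /existsP[q uq]].
by rewrite -(size_tuple q); exact: Cd uq.
Qed.

Lemma node_valueE (I O : finType) (C : circuit I O) (x : {ffun I -> bool}) :
  node_value x = update x (node_value x) :> (node C -> bool).
Proof.
rewrite /node_value; set f := fun=> false.
suff H k (u : node C) :
    (forall w q, path (edge (@wire _ _ C)) w q -> last w q = u -> (size q < k)%N) ->
    iter k (update x) f u = iter k.+1 (update x) f u.
  by apply/funext => u; apply: H => w q wq _; exact: circuit_path_size wq.
elim: k u => [|k IHk] u Hu; first by have := Hu u [::] isT erefl.
case: u Hu => [//|g] Hg.
have IH w : wire w g -> iter k (update x) f w = iter k.+1 (update x) f w.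
  move=> wg; apply: IHk => y q yq qw.
  have := Hg y (rcons q (inr g)); rewrite size_rcons ltnS; apply.
    by rewrite rcons_path yq qw.
  by rewrite last_rcons.
rewrite /=; case: (op g).
- by apply: eq_forallb => w; case wg: (wire w g) => //; rewrite IH.
- by apply: eq_existsb => w; case wg: (wire w g) => //; rewrite IH.
- by apply: eq_existsb => w; case wg: (wire w g) => //; rewrite IH.
Qed.

Definition in_circuit_family (R : realType) (p n s d : nat) (rho : R)
    (C : circuit (multi_index p n) 'I_n) : Prop :=
  [/\ (csize C <= s)%N, (cdepth C <= d)%N &
     forall J : tensor p n, 0 <= max_energy R J ->
       rho * max_energy R J <= energy R J (ceval C J)].

(* Main.v *)
Require Import Defs.
From mathcomp Require Import all_boot all_order all_algebra.
From mathcomp Require Import ring lra zify.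
Set Implicit Arguments.
Unset Strict Implicit.
Unset Printing Implicit Defensive.
Import Order.TTheory GRing.Theory Num.Theory.
Local Open Scope ring_scope.

(* Idea.  By a switching lemma, the outputs of a circuit of size [s] and depth
   [d] have average sensitivity [(O(log (n s))) ^ (d + 2)], which is at most
   [n ^ (3/4)] when [s < n ^ alpha] and [d < log n / (2 log log n)].  A jump is
   a step of the interpolation path at which a positive fraction of the [n]
   outputs change; a random step of the cube is one with small probability, and
   a Jensen argument shows that the whole path is free of jumps with
   probability at least [exp (- O(n ^ (3/4)))].  On such a path the overlap
   with the initial output cannot cross the gap [(nu1, nu2)], although it
   starts at 1 and must end below [nu1]; so the path leaves the OGP event or
   meets a tensor of atypical maximum, which has probability at most
   [exp (- Omega(n))], a contradiction for large [n]. *)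

(** * Random restrictions *)

Section Cube.
Variable V : finType.
Implicit Types (A S T : {set V}) (x y z : {ffun V -> bool}).
Implicit Types (f : {ffun V -> bool} -> bool).

(** A restriction is a pair [(A, x)]: variables in [A] stay free, the others are fixed by [x].
    Keeping [x] total makes averages over restrictions plain sums over the cube. *)
Definition mix A z x : {ffun V -> bool} := [ffun i => if i \in A then z i else x i].
Definition flip S y : {ffun V -> bool} := [ffun i => y i (+) (i \in S)].
Definition agree S x y := [forall i in S, x i == y i].
(** Certificate complexity at most [t] at [x]. If all true points are certified, [f] is a DNF of
    width [t]; if all false points are, a CNF. *)
Definition certified f (t : nat) x :=
  [exists S : {set V}, (#|S| <= t)%N && [forall y, agree S x y ==> (f y == f x)]].
Definition restricted f A x := fun z => f (mix A z x).
(** Average sensitivity times the size of the cube. *)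
Definition total_sensitivity f : nat :=
  \sum_x #|[set i | f (flip [set i] x) != f x]|.

Lemma agreeP S x y : reflect {in S, forall i, x i = y i} (agree S x y).
Proof. by apply: (iffP 'forall_in_eqP). Qed.

Lemma certifiedP f t x : reflect
  (exists2 S : {set V}, (#|S| <= t)%N & forall y, {in S, forall i, x i = y i} -> f y = f x)
  (certified f t x).
Proof.
apply: (iffP existsP) => [[S /andP[St /forallP Sf]]|[S St Sf]].
  by exists S => // y /agreeP xy; apply/eqP; have /implyP := Sf y; apply.
exists S; rewrite St; apply/forallP => y; apply/implyP => /agreeP xy.
by rewrite (Sf _ xy).
Qed.

Lemma flipK S : involutive (flip S).
Proof. by move=> x; apply/ffunP => i; rewrite !ffunE addbK. Qed.

Lemma flip_diff S x y : (forall i, i \notin S -> x i = y i) ->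
  exists2 S' : {set V}, S' \subset S & x = flip S' y.
Proof.
move=> xy; exists [set i | x i != y i].
  by apply/subsetP => i; rewrite inE; apply: contraR => /xy ->.
by apply/ffunP => i; rewrite !ffunE inE; case: (x i) (y i) => [] [].
Qed.

Lemma certified_restrict f A x t z :
  certified f t (mix A z x) -> certified (restricted f A x) t z.
Proof.
move=> /certifiedP[S St Sf]; apply/certifiedP; exists S => // y zy.
by apply: Sf => i iS; rewrite !ffunE; case: ifP => // _; exact: zy.
Qed.

Lemma certifiedN f t x : certified (fun y => ~~ f y) t x = certified f t x.
Proof.
apply/certifiedP/certifiedP => -[S St Sf]; exists S => // y /Sf.
  by move/negb_inj.
by move=> ->.
Qed.

(** Every sensitive coordinate lies in every certificate. *)
Lemma card_sensitive_certified f t x : certified f t x ->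
  (#|[set i | f (flip [set i] x) != f x]| <= t)%N.
Proof.
move=> /certifiedP[S St Sf]; apply: leq_trans St; apply/subset_leq_card/subsetP => i.
rewrite inE; apply: contraR => iS; apply/eqP/Sf => j jS.
by rewrite ffunE inE; case: eqP => [ji|]; [rewrite -ji jS in iS|rewrite addbF].
Qed.

(* A pair [(C, a)] stands for the conjunction of the literals saying that the
   argument agrees with [a] on [C]. *)
Definition term := ({set V} * {ffun V -> bool})%type.
Definition falsified A x (c : term) := [exists i in c.1 :\: A, x i != c.2 i].

Section Decoder.
Variable L : seq term.

(* Inverts the encoding of Razborov's proof of the switching lemma: the first
   term satisfied by the code [y] is the first one that the restriction leaves
   open, [T1] is the set of its free variables, [S1] corrects [y] into the code
   of the rest, and [S2] restores the original values on [T1]. *)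
Fixpoint decode (n : nat) y : seq ({set V} * {ffun V -> bool}) :=
  if n is n'.+1 then
    (set0, y) ::
    if ohead [seq c <- L | agree c.1 c.2 y] is Some c then
      flatten [seq flatten [seq flatten [seq
        [seq (T1 :|: e.1, flip S2 e.2)
          | e : {set V} * {ffun V -> bool} <- decode n' (flip S1 y) & [disjoint T1 & e.1]]
        | S2 <- enum (powerset T1)]
        | S1 <- enum (powerset T1)]
        | T1 <- enum (powerset c.1) & T1 != set0]
    else [::]
  else [:: (set0, y)].

(** [T] collects the variables queried by the canonical decision tree on [z]: take the first term
    not yet falsified, query its free variables, recurse. Once all terms are falsified, [f] is false
    whatever the other free variables are, so [T] is a certificate. The code [y] instead sets each
    queried block so as to satisfy its term. *)
Lemma encode_path f A x z :
  (forall c y, c \in L -> agree c.1 c.2 y -> f y) ->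
  (forall y, f y -> exists2 c, c \in L & agree c.1 c.2 y) ->
  ~~ f (mix A z x) ->
  exists T y, [/\ T \subset A,
    forall u : {ffun V -> bool}, {in T, forall i, z i = u i} -> ~~ f (mix A u x),
    forall i, i \notin T -> y i = x i &
    forall n, (#|A| <= n)%N -> (T, x) \in decode n y].
Proof.
move=> Lf fL; have [m] := ubnP #|A|; elim: m A x => // m IHm A x Am fz.
case Eo: (ohead [seq c <- L | ~~ falsified A x c]) => [c|]; last first.
  exists set0, x; split => //; first exact: sub0set.
  - move=> u _; apply/negP => /fL[c cL cu].
    have : c \in [seq c <- L | ~~ falsified A x c].
      rewrite mem_filter cL andbT; apply/exists_inP => -[i].
      rewrite inE => /andP[iA ic]; have /agreeP/(_ i ic) := cu.
      by rewrite ffunE (negPf iA) => ->; rewrite eqxx.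
    by case: [seq _ <- _ | _] Eo.
  - by case=> [|n] _ /=; rewrite inE eqxx.
have [L1 [L2 [LE cx L1x]]] : exists L1 L2, [/\ L = L1 ++ c :: L2,
    ~~ falsified A x c & all (falsified A x) L1].
  elim: (L) Eo => //= c' L' IH; case: ifP => [cx [<-]|/negbFE cx /IH[L1 [L2 [-> ? ?]]]].
    by exists [::], L'.
  by exists (c' :: L1), L2; split=> //=; rewrite cx.
have cL : c \in L by rewrite LE mem_cat inE eqxx orbT.
set T1 := c.1 :&: A.
have xc i : i \in c.1 -> i \notin A -> x i = c.2 i.
  move=> ic iA; apply/eqP; apply: contraR cx => xi.
  by apply/exists_inP; exists i => //; rewrite inE iA.
have T1n0 : T1 != set0.
  apply: contraNneq fz => T10; apply: (Lf c) => //; apply/agreeP => i ic.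
  rewrite ffunE; case: ifP => [iA|/negbT iA]; last by rewrite xc.
  by have := in_set0 i; rewrite -T10 inE ic iA.
set x1 := mix T1 z x.
have mixE (u : {ffun V -> bool}) :
    {in T1, forall i, z i = u i} -> mix (A :\: T1) u x1 = mix A u x.
  move=> zu; apply/ffunP => i; rewrite !ffunE inE.
  have [iT|iT] /= := boolP (i \in T1); last by [].
  by rewrite zu //; case/setIP: iT => _ ->.
have T1A : T1 \subset A by exact: subsetIr.
have cardA : #|A| = (#|T1| + #|A :\: T1|)%N.
  by rewrite cardsD (setIidPr T1A) subnKC // subset_leq_card.
have T1_gt0 : (0 < #|T1|)%N by rewrite card_gt0.
have [||T2 [y' [T2A T2f y'x Dy']]] := IHm (A :\: T1) x1.
- by rewrite cardA in Am; lia.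
- by rewrite mixE.
have T12 : [disjoint T1 & T2].
  rewrite disjoint_sym disjoints_subset; apply: subset_trans T2A _.
  by rewrite setDE subsetIr.
exists (T1 :|: T2), (mix T1 c.2 y'); split.
- by rewrite subUset T1A (subset_trans T2A) // subsetDl.
- move=> u zu; rewrite -mixE; last by move=> i iT; rewrite zu // inE iT.
  by apply: T2f => i iT; rewrite zu // inE iT orbT.
- move=> i; rewrite inE negb_or => /andP[iT1 iT2].
  by rewrite ffunE (negPf iT1) y'x // ffunE (negPf iT1).
move=> [|n] An; first by rewrite leqn0 cards_eq0 in An;
  move: T1A T1n0; rewrite (eqP An) subset0 => ->.
set y := mix T1 c.2 y'.
have yx i : i \notin A -> y i = x i.
  move=> iA; have iT1 : i \notin T1 by apply: contra iA => /(subsetP T1A).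
  have iT2 : i \notin T2 by apply: contra iA => /(subsetP T2A); rewrite inE => /andP[].
  by rewrite ffunE (negPf iT1) y'x // ffunE (negPf iT1).
have -> : decode n.+1 y = (set0, y) ::
      flatten [seq flatten [seq flatten [seq
        [seq (T1 :|: e.1, flip S2 e.2)
          | e : {set V} * {ffun V -> bool} <- decode n (flip S1 y) & [disjoint T1 & e.1]]
        | S2 <- enum (powerset T1)]
        | S1 <- enum (powerset T1)]
        | T1 <- enum (powerset c.1) & T1 != set0].
  (* Earlier terms are falsified outside [A], where [y] agrees with [x], and [y] satisfies [c]; so
     the decoder selects [c]. *)
  rewrite /=; suff -> : ohead [seq c <- L | agree c.1 c.2 y] = Some c by [].
  rewrite LE filter_cat /= (_ : agree c.1 c.2 y).
    rewrite (_ : [seq _ <- L1 | _] = [::]) //.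
    apply/eqP; rewrite -(negbK (_ == _)) -has_filter; apply/hasPn => c' c'L.
    have /allP/(_ _ c'L)/exists_inP[i] := L1x; rewrite inE => /andP[iA ic] xi.
    by apply: contra xi => /agreeP ->//; rewrite yx.
  apply/agreeP => i ic; have [iA|iA] := boolP (i \in A); last by rewrite yx // xc.
  by rewrite ffunE inE ic iA.
rewrite inE; apply/orP; right.
have [S1 S1T y'E] : exists2 S1 : {set V}, S1 \subset T1 & y' = flip S1 y.
  by apply: flip_diff => i iT; rewrite ffunE (negPf iT).
have [S2 S2T xE] : exists2 S2 : {set V}, S2 \subset T1 & x = flip S2 x1.
  by apply: flip_diff => i iT; rewrite ffunE (negPf iT).
apply/flatten_mapP; exists T1; first by rewrite mem_filter T1n0 mem_enum powersetE subsetIl.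
apply/flatten_mapP; exists S1; first by rewrite mem_enum powersetE.
apply/flatten_mapP; exists S2; first by rewrite mem_enum powersetE.
apply/mapP; exists (T2, x1); last by rewrite /= -xE.
by rewrite mem_filter T12 -y'E Dy' //; lia.
Qed.

End Decoder.
End Cube.

(** * Weighted counting and the switching lemma *)

Section Weights.
Variables (R : realFieldType) (V : finType).
Implicit Types (A S T C : {set V}).

Lemma sum_expr_subset C (a : R) :
  \sum_(T : {set V} | T \subset C) a ^+ #|T| = (1 + a) ^+ #|C|.
Proof.
transitivity (\prod_i ((if i \in C then a else 0) + 1)); last first.
  rewrite -prodr_const [RHS]big_mkcond; apply: eq_bigr => i _.
  by case: ifP; rewrite ?add0r // addrC.
rewrite bigA_distr big_mkcond; apply: eq_bigr => T _.
case: ifP => [TC|/negbT/subsetPn[i iT iC]]; last first.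
  by rewrite (bigD1 i) //= iT (negPf iC) mul0r.
rewrite -prodr_const big_mkcond; apply: eq_bigr => i _.
by case: ifP => // /(subsetP TC) ->.
Qed.

(** A block [T1] has weight [q ^+ #|T1|] and [4 ^ #|T1|] choices of [(S1, S2)], so the nonempty
    blocks inside [c.1] weigh [(1 + 4q)^#|c.1| - 1 <= 8wq <= 1/2] in total. By induction the rest
    weighs at most 2, which gives [1 + 2/2 = 2]. *)
Lemma decode_weight (q : R) (w : nat) (L : seq (term V)) n y :
  0 <= q -> 16 * w%:R * q <= 1 -> (forall c, c \in L -> (#|c.1| <= w)%N) ->
  \sum_(e <- decode L n y) q ^+ #|e.1| <= 2.
Proof.
move=> q0 wq Lw; elim: n y => [|n IHn] y /=.
  by rewrite big_seq1 /= cards0 expr0 ler1n.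
rewrite big_cons cards0 expr0 -[leRHS]/(1 + 1) lerD2l.
case Eo: (ohead _) => [c|]; last by rewrite big_nil ler01.
have cw : (#|c.1| <= w)%N.
  apply: Lw; suff: c \in [seq c <- L | agree c.1 c.2 y] by rewrite mem_filter => /andP[].
  by move: Eo; case: [seq _ <- _ | _] => //= c' s [<-]; rewrite inE eqxx.
have q40 : 0 <= 4 * q by rewrite mulr_ge0.
suff H (T1 S1 S2 : {set V}) : \sum_(e <- [seq (T1 :|: e.1, flip S2 e.2)
          | e : {set V} * {ffun V -> bool} <- decode L n (flip S1 y) & [disjoint T1 & e.1]])
       q ^+ #|e.1| <= 2 * q ^+ #|T1|.
  have : \sum_(T1 : {set V} | (T1 \subset c.1) && (T1 != set0))
       2 * (4 * q) ^+ #|T1| <= 1.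
    rewrite -mulr_sumr.
    have -> : \sum_(T1 : {set V} | (T1 \subset c.1) && (T1 != set0)) (4 * q) ^+ #|T1|
        = (1 + 4 * q) ^+ #|c.1| - 1.
      rewrite -sum_expr_subset [in RHS](bigD1 set0) ?sub0set //= cards0 expr0.
      by rewrite addrAC subrr add0r.
    (* A converse of Bernoulli's inequality: [(1 + a)^k <= 1 + 2ka] as long as [2ka <= 1]. *)
    have : (1 + 4 * q) ^+ #|c.1| <= 1 + 2 * #|c.1|%:R * (4 * q).
      have : 2 * #|c.1|%:R * (4 * q) <= 1.
        apply: le_trans wq; rewrite (_ : _ * _ = 8 * #|c.1|%:R * q); last by ring.
        apply: ler_wpM2r => //; apply: ler_pM => //; first by rewrite ler_nat.
        by rewrite ler_nat.
      elim: #|c.1| => [|k IHk]; first by rewrite expr0 mulr0 mul0r addr0.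
      rewrite -[k.+1%:R]natr1 => kq.
      have {}IHk : (1 + 4 * q) ^+ k <= 1 + 2 * k%:R * (4 * q).
        by apply: IHk; apply: le_trans kq; rewrite ler_wpM2r // ler_wpM2l // lerDl.
      rewrite exprSr; have k0 : 0 <= k%:R :> R by [].
      have : (1 + 4 * q) ^+ k * (1 + 4 * q) <= (1 + 2 * k%:R * (4 * q)) * (1 + 4 * q).
        by apply: ler_wpM2r => //; lra.
      move: kq IHk k0; set a := 4 * q in q40 *; move: (k%:R) => K kq _ K0 h.
      apply: le_trans h _; rewrite -subr_ge0.
      by rewrite (_ : _ - _ = a * (1 - 2 * K * a)); [apply: mulr_ge0 => //; nra|ring].
    have : #|c.1|%:R <= w%:R :> R by rewrite ler_nat.
    have : 0 <= #|c.1|%:R :> R by [].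
    by nra.
  apply: le_trans; rewrite big_flatten big_map big_filter big_enum_cond /=.
  rewrite [X in _ <= X](eq_bigl (fun i => (i \in powerset c.1) && (i != set0))); last first.
    by move=> T; rewrite powersetE.
  apply: ler_sum => T1 _; rewrite big_flatten big_map big_enum /=.
  have -> : 2 * (4 * q) ^+ #|T1| =
     \sum_(S1 in powerset T1) \sum_(S2 in powerset T1) 2 * q ^+ #|T1|.
    rewrite !sumr_const card_powerset -!mulrnA -[_ *+ (_ * _)]mulr_natl natrM natrX exprMn.
    by rewrite (_ : 4 = 2 * 2) ?exprMn; ring.
  apply: ler_sum => S1 _; rewrite big_flatten big_map big_enum /=.
  by apply: ler_sum => S2 _; exact: H.
rewrite big_map big_filter big_mkcond /=.
apply: le_trans (_ : \sum_(e <- decode L n (flip S1 y)) q ^+ #|T1| * q ^+ #|e.1| <= _).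
  apply: ler_sum => e _; case: ifP => [d|_]; last by rewrite mulr_ge0 // exprn_ge0.
  by rewrite -exprD cardsU disjoint_setI0 // cards0 subn0.
rewrite -mulr_sumr mulrC; apply: ler_wpM2r; [exact: exprn_ge0|exact: IHn].
Qed.

(** The probability of [A] when each variable is left free independently with probability
    [delta]. *)
Definition rweight (delta : R) A : R := delta ^+ #|A| * (1 - delta) ^+ #|~: A|.

Lemma rweight_ge0 (delta : R) A : 0 <= delta <= 1 -> 0 <= rweight delta A.
Proof. by move=> /andP[d0 d1]; rewrite mulr_ge0 // exprn_ge0 // subr_ge0. Qed.

Lemma sum_rweight_supset (delta : R) T :
  \sum_(A : {set V} | T \subset A) rweight delta A = delta ^+ #|T|.
Proof.
transitivity (\prod_i (delta + (if i \in T then 0 else 1 - delta))); last first.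
  rewrite -prodr_const [RHS]big_mkcond; apply: eq_bigr => i _.
  by case: ifP; rewrite ?addr0 // addrC subrK.
rewrite bigA_distr big_mkcond; apply: eq_bigr => A _.
case: ifP => [TA|/negbT/subsetPn[i iT iA]]; last first.
  by rewrite (bigD1 i) //= (negPf iA) iT mul0r.
rewrite /rweight -!prodr_const big_mkcond [X in _ * X]big_mkcond -big_split /=.
apply: eq_bigr => i _; rewrite inE; case: ifP => iA; first by rewrite mulr1.
by rewrite mul1r ifF //; apply: contraFF iA => /(subsetP TA).
Qed.

Lemma sum_rweight (delta : R) : \sum_(A : {set V}) rweight delta A = 1.
Proof.
transitivity (delta ^+ #|@set0 V|); last by rewrite cards0.
by rewrite -sum_rweight_supset; apply: eq_bigl => A; rewrite sub0set.
Qed.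

Implicit Types (f : {ffun V -> bool} -> bool).

(** Here [b] is the value that already has short certificates; failure concerns the opposite
    value. *)
Definition switching_fails f (b : bool) t A x := [exists z : {ffun V -> bool},
  (restricted f A x z != b) && ~~ certified (restricted f A x) t z].

(** Each failing [(A, x)] is decoded from some [y] as a pair [(T, x)] with [T \subset A] and
    [#|T| > t]. The list decoded from [y] does not depend on [A], and [A] contains [T] with
    probability [delta ^+ #|T|]; it remains to sum over [y]. *)
Lemma switching_true (delta : R) f w t :
  0 <= delta <= 1 -> 32 * w%:R * delta <= 1 ->
  (forall x, f x -> certified f w x) ->
  \sum_A rweight delta A * \sum_x (switching_fails f true t A x)%:R
    <= 2 * 2 ^- t * #|{ffun V -> bool}|%:R.
Proof.
move=> d01 dw fw; have /andP[d0 d1] := d01.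
(* All terms of width at most [w] that imply [f]; by the certificates at true points their
   disjunction is [f]. *)
pose L := enum [pred c : term V | (#|c.1| <= w)%N & [forall y, agree c.1 c.2 y ==> f y]].
have fL y : f y -> exists2 c, c \in L & agree c.1 c.2 y.
  move=> fy; have /certifiedP[S Sw Sf] := fw _ fy; exists (S, y); last exact/agreeP.
  rewrite mem_enum inE /= Sw; apply/forallP => u; apply/implyP => /agreeP yu.
  by rewrite Sf.
have Lf c y : c \in L -> agree c.1 c.2 y -> f y.
  by rewrite mem_enum inE => /andP[_ /forallP/(_ y)/implyP].
have Lw c : c \in L -> (#|c.1| <= w)%N by rewrite mem_enum inE => /andP[].
pose D y := decode L #|V| y.
apply: le_trans (_ : \sum_A rweight delta A * (\sum_x \sum_y \sum_(e <- D y)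
   [&& e.2 == x, e.1 \subset A & (t < #|e.1|)%N]%:R) <= _).
  apply: ler_sum => A _; apply: ler_wpM2l; first exact: rweight_ge0.
  apply: ler_sum => x _;
  have [/existsP[z /andP[fz cz]]|_] := boolP (switching_fails _ _ _ _ _); last first.
    by apply: sumr_ge0 => y _; apply: sumr_ge0.
  have {}fz : ~~ f (mix A z x) by move: fz; rewrite /restricted; case: (f _).
  have [T [y [TA Tf _ Dy]]] := encode_path Lf fL fz.
  have tT : (t < #|T|)%N.
    rewrite ltnNge; apply: contra cz => Tt; apply/certifiedP; exists T => // u zu.
    rewrite /restricted (negPf fz); apply/negbTE/Tf => i iT.
    by rewrite zu.
  rewrite (bigD1 y) //= -[leLHS]addr0; apply: lerD; last first.
    by apply: sumr_ge0 => y' _; apply: sumr_ge0.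
  have {}Dy : (T, x) \in D y by apply: Dy; exact: max_card.
  by rewrite (big_rem _ Dy) /= eqxx TA tT /= lerDl; apply: sumr_ge0.
set lhs := leLHS.
have -> : lhs = \sum_y \sum_(e <- D y) (t < #|e.1|)%N%:R * delta ^+ #|e.1|.
  rewrite /lhs.
  transitivity (\sum_A \sum_y \sum_(e <- D y)
      rweight delta A * ((e.1 \subset A) && (t < #|e.1|)%N)%:R).
    apply: eq_bigr => A _; rewrite exchange_big mulr_sumr /=; apply: eq_bigr => y _.
    rewrite exchange_big mulr_sumr /=; apply: eq_bigr => e _; congr (_ * _).
    rewrite (bigD1 e.2) //= eqxx /= big1 ?addr0 // => x xe.
    by rewrite eq_sym (negPf xe).
  rewrite exchange_big /=; apply: eq_bigr => y _.
  rewrite exchange_big /=; apply: eq_bigr => e _.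
  rewrite -sum_rweight_supset mulr_sumr [RHS]big_mkcond; apply: eq_bigr => A _.
  by case: (e.1 \subset A); case: (t < _)%N; rewrite /= ?mulr1 ?mulr0 ?mul1r ?mul0r.
rewrite mulr_natr -sumr_const; apply: ler_sum => y _.
(* As [#|e.1| > t], a factor [2 ^- t] comes out at the cost of doubling [delta], hence 32 here
   against 16 in [decode_weight]. *)
apply: le_trans (_ : \sum_(e <- D y) 2 ^- t * (2 * delta) ^+ #|e.1| <= _).
  apply: ler_sum => e _; have [te|te] := boolP (t < #|e.1|)%N; last first.
    by rewrite mul0r mulr_ge0 ?invr_ge0 ?exprn_ge0 ?mulr_ge0.
  rewrite mul1r exprMn mulrA ler_peMl ?exprn_ge0 //.
  by rewrite mulrC ler_pdivlMr ?exprn_gt0 // mul1r ler_weXn2l ?ler1n // ltnW.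
rewrite -mulr_sumr mulrC; apply: ler_wpM2r; first by rewrite invr_ge0 exprn_ge0.
apply: (@decode_weight _ w) => //; first by rewrite mulr_ge0.
by apply: le_trans dw; rewrite le_eqVlt; apply/orP; left; apply/eqP; ring.
Qed.

Lemma switching (delta : R) f b w t :
  0 <= delta <= 1 -> 32 * w%:R * delta <= 1 ->
  (forall x, f x = b -> certified f w x) ->
  \sum_A rweight delta A * \sum_x (switching_fails f b t A x)%:R
    <= 2 * 2 ^- t * #|{ffun V -> bool}|%:R.
Proof.
case: b => d01 dw fw; first exact: switching_true d01 dw fw.
have h x : ~~ f x -> certified (fun y => ~~ f y) w x.
  by move/negbTE/fw; rewrite certifiedN.
apply: le_trans (@switching_true delta _ w t d01 dw h).
rewrite le_eqVlt; apply/predU1P; left; apply: eq_bigr => A _; congr (_ * _).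
apply: eq_bigr => x _; congr ((nat_of_bool _)%:R); apply: eq_existsb => z.
rewrite (certifiedN (restricted f A x)) /restricted.
by case: (f _).
Qed.

(** Exchanging [x] and [z] outside [A] is an involution on pairs that turns [mix A z x] into [z]. *)
Lemma sum_mix A (F : {ffun V -> bool} -> R) :
  \sum_x \sum_z F (mix A z x) = #|{ffun V -> bool}|%:R * \sum_y F y.
Proof.
rewrite pair_bigA /=; pose h (u : {ffun V -> bool} * {ffun V -> bool}) :=
  (mix A u.1 u.2, mix A u.2 u.1).
have hK : involutive h.
  by move=> [x z]; rewrite /h; congr pair; apply/ffunP => i; rewrite !ffunE; case: (i \in A).
rewrite (reindex_inj (inv_inj hK)) /=.
transitivity (\sum_(x : {ffun V -> bool}) \sum_z F z).
  rewrite [RHS]pair_bigA; apply: eq_bigr => -[x z] _ /=; congr F.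
  by apply/ffunP => i; rewrite !ffunE; case: (i \in A).
by rewrite sumr_const mulr_natl.
Qed.

(** A sensitive direction survives exactly when it is free, which has probability [delta]. *)
Lemma total_sensitivity_restrict (delta : R) f :
  \sum_A rweight delta A * \sum_x (total_sensitivity (restricted f A x))%:R
    = delta * #|{ffun V -> bool}|%:R * (total_sensitivity f)%:R.
Proof.
have card_sum (g : {ffun V -> bool} -> bool) :
    (total_sensitivity g)%:R = \sum_x \sum_i (g (flip [set i] x) != g x)%:R :> R.
  rewrite /total_sensitivity natr_sum; apply: eq_bigr => x _.
  by rewrite -sum1dep_card natr_sum big_mkcond; apply: eq_bigr => i _; case: (_ != _).
transitivity (\sum_A \sum_i rweight delta A * (#|{ffun V -> bool}|%:R *
    \sum_y ((i \in A) && (f (flip [set i] y) != f y))%:R)).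
  apply: eq_bigr => A _; rewrite -mulr_sumr; congr (_ * _).
  rewrite -mulr_sumr exchange_big /= -(sum_mix A); apply: eq_bigr => x _.
  rewrite card_sum; apply: eq_bigr => z _; apply: eq_bigr => i _.
  rewrite /restricted; congr ((nat_of_bool _)%:R); have [iA|iA] /= := boolP (i \in A).
    congr (f _ != _); apply/ffunP => j; rewrite !ffunE inE.
    by have [->|_] := eqVneq j i; rewrite ?iA ?addbF.
  suff -> : mix A (flip [set i] z) x = mix A z x by rewrite eqxx.
  apply/ffunP => j; rewrite !ffunE inE.
  by have [->|_] := eqVneq j i; rewrite ?(negPf iA) ?addbF.
rewrite exchange_big card_sum [in RHS]exchange_big [RHS]mulr_sumr; apply: eq_bigr => i _ /=.
rewrite -[X in X * _ * _]expr1 -[in X in X * _](cards1 i) -sum_rweight_supset.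
rewrite [in RHS]big_mkcond !mulr_suml; apply: eq_bigr => A _; rewrite sub1set.
case: (i \in A) => /=; first by rewrite mulrA.
by rewrite big1 ?mulr0 ?mul0r.
Qed.
End Weights.

(* Imported only now because classical_sets shadows the names of finset. *)
From mathcomp Require Import all_classical all_reals all_analysis.
Local Open Scope ring_scope.

(** * Average sensitivity of circuits *)

Section CircuitSensitivity.
Variables (R : realFieldType) (I O : finType) (C : circuit I O).
Implicit Types (F : node C -> {ffun I -> bool} -> bool) (t r : nat).

(** Arbitrary node functions obeying the gates are allowed, because restricting the inputs preserves
    this property. *)
Definition gate_consistent F :=
  forall g x, F (inr g) x = update x (F^~ x) (inr g).

(** The depth of [u] is less than [r]. The empty path makes [below 0] unsatisfiable, so the
    induction on levels can start there. *)
Definition below r (u : node C) := forall w q,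
  path (edge (@wire _ _ C)) w q -> last w q = u -> (size q < r)%N.

Lemma below_wire r w g : below r.+1 (inr g) -> wire w g -> below r w.
Proof.
move=> rg wg v q vq qw; rewrite -ltnS -(size_rcons q (inr g)).
by apply: (rg v); rewrite ?last_rcons // rcons_path vq qw.
Qed.

(** The value [b] is forced by a single input of value [c]: a false one for [And] and [Not], a true
    one for [Or]. A certificate for that input serves the gate, whatever the fan-in. *)
Lemma certified_gate F t g : gate_consistent F ->
  (forall u, wire u g -> forall x, certified (F u) t x) ->
  exists b, forall x, F (inr g) x = b -> certified (F (inr g)) t x.
Proof.
move=> FC Ft.
pose b := if op g is And then false else true.
pose c := if op g is Or then true else false.
have Fg x : F (inr g) x = b <-> exists2 u, wire u g & F u x = c.
  rewrite FC /= /b /c; case: (op g).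
  - split=> [/forallPn[u]|[u ug Fu]].
      by rewrite negb_imply => /andP[ug /negbTE Fu]; exists u.
    by apply/negbTE/forallPn; exists u; rewrite ug Fu.
  - split=> [/existsP[u /andP[ug Fu]]|[u ug Fu]]; first by exists u.
    by apply/existsP; exists u; rewrite ug Fu.
  - split=> [/existsP[u /andP[ug /negbTE Fu]]|[u ug Fu]]; first by exists u.
    by apply/existsP; exists u; rewrite ug Fu.
exists b => x Fx; have [u ug Fu] := (Fg x).1 Fx.
have /certifiedP[S St Sf] := Ft u ug x; apply/certifiedP; exists S => // y xy.
by rewrite Fx; apply/Fg; exists u => //; rewrite Sf.
Qed.

Lemma total_sensitivity_certified (f : {ffun I -> bool} -> bool) t :
  (forall x, certified f t x) -> (total_sensitivity f <= #|{ffun I -> bool}| * t)%N.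
Proof.
move=> ft; rewrite -sum_nat_const; apply: leq_sum => x _.
exact: card_sensitive_certified.
Qed.

Lemma total_sensitivity_max (f : {ffun I -> bool} -> bool) :
  (total_sensitivity f <= #|{ffun I -> bool}| * #|I|)%N.
Proof. by rewrite -sum_nat_const; apply: leq_sum => x _; exact: max_card. Qed.

(* One round of random restriction certifies one more level of the circuit and
   multiplies the average sensitivity by [(64 t)^-1]. *)
Lemma total_sensitivity_levels t j r F :
  (0 < t)%N -> (2 * #|I| * csize C <= 2 ^ t)%N ->
  gate_consistent F -> (forall i x, certified (F (inl i)) 1 x) ->
  (forall u, below r u -> forall x, certified (F u) t x) ->
  forall u, below (r + j) u ->
  (total_sensitivity (F u))%:R
    <= #|{ffun I -> bool}|%:R * ((128 * t%:R) ^+ j * t%:R) :> R.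
Proof.
move=> t0 tC; elim: j r F => [|j IHj] r F FC Fi Fr u.
  rewrite addn0 expr0 mul1r => ru; rewrite -natrM ler_nat.
  exact: total_sensitivity_certified (Fr u ru).
rewrite addnS -addSn => ru; pose M : R := #|{ffun I -> bool}|%:R.
have M0 : 0 < M.
  by rewrite ltr0n; apply/card_gt0P; exists [ffun=> true].
(* Then [32 * t * delta = 1/2], within the range of [switching]. *)
pose delta : R := (64 * t%:R)^-1.
have tR : 1 <= t%:R :> R by rewrite ler1n.
have d0 : 0 < delta by rewrite invr_gt0; lra.
have tdelta : 64 * t%:R * delta = 1 by rewrite mulfV //; lra.
have d1 : delta <= 1 by nra.
have d01 : 0 <= delta <= 1 by rewrite ltW.
(* Gates that are too deep get the dummy value [true]; [fails] does not count them. *)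
have gateb (g : gate C) : exists b, below r.+1 (inr g) ->
    forall x, F (inr g) x = b -> certified (F (inr g)) t x.
  have [rg|rg] := pselect (below r.+1 (inr g)); last by exists true.
  have [|b Hb] := @certified_gate F t g FC; last by exists b => _.
  by move=> w wg; apply: Fr; exact: below_wire rg wg.
have [b Fb] := choice gateb.
pose fails A x := \sum_g (`[< below r.+1 (inr g) >] &&
  switching_fails (F (inr g)) (b g) t A x)%:R : R.
pose X : R := (128 * t%:R) ^+ j * t%:R.
have X1 : 1 <= X.
  rewrite -[1]mulr1 ler_pM // exprn_ege1 //; lra.
(* If no gate fails, the induction hypothesis applies one level higher; otherwise the trivial bound
   [#|I|] per point is charged to [fails]. *)
have key A x : (total_sensitivity (restricted (F u) A x))%:R
    <= M * X + M * #|I|%:R * fails A x.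
  have fails0 : 0 <= fails A x by apply: sumr_ge0.
  have [/existsP[g gA]|/existsPn nbad] := boolP [exists g, `[< below r.+1 (inr g) >] &&
      switching_fails (F (inr g)) (b g) t A x].
    apply: le_trans (_ : M * #|I|%:R <= _).
      by rewrite /M -natrM ler_nat total_sensitivity_max.
    have f1 : 1 <= fails A x.
      by rewrite /fails (bigD1 g) //= gA lerDl; apply: sumr_ge0.
    rewrite -[leLHS]add0r lerD //; first by rewrite mulr_ge0 ?ltW //; lra.
    by rewrite ler_peMr // mulr_ge0 // ltW.
  apply: le_trans (_ : M * X <= _); last by rewrite lerDl !mulr_ge0 // ltW.
  apply: (IHj r.+1 (fun v => restricted (F v) A x)) => //.
  - by move=> g z; rewrite /restricted FC.
  - by move=> i z; apply: certified_restrict.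
  case=> [i|g] rv z.
    have /certifiedP[S S1 Sf] := certified_restrict (Fi i (mix A z x)).
    by apply/certifiedP; exists S => //; apply: leq_trans t0.
  have [Fz|Fz] := eqVneq (restricted (F (inr g)) A x z) (b g).
    by apply: certified_restrict; apply: Fb.
  have := nbad g; rewrite asboolT //= => /existsPn/(_ z).
  by rewrite Fz negbK.
have E : delta * M * (total_sensitivity (F u))%:R <= M * (M * X) + M * M.
  rewrite -total_sensitivity_restrict.
  apply: le_trans (_ : \sum_A (rweight delta A * (M * (M * X)) +
      M * #|I|%:R * (rweight delta A * \sum_x fails A x)) <= _).
    apply: ler_sum => A _.
    rewrite [X in _ + X]mulrCA -mulrDr; apply: ler_wpM2l; first exact: rweight_ge0.
    apply: le_trans (_ : \sum_x (M * X + M * #|I|%:R * fails A x) <= _); last first.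
      by rewrite big_split sumr_const -mulr_sumr -[_ *+ #|_|]mulr_natl.
    by apply: ler_sum => x _; exact: key.
  rewrite big_split -mulr_suml sum_rweight mul1r -mulr_sumr /= lerD2l -mulrA.
  apply: ler_wpM2l; first exact: ltW.
  (* Union bound over the gates; the size condition on [2 ^ t] keeps the contribution of failures
     below [M * M]. *)
  apply: le_trans (_ : #|I|%:R * \sum_(g : gate C) 2 * 2 ^- t * M <= _).
    apply: ler_wpM2l => //; rewrite /fails.
    under eq_bigr do rewrite exchange_big mulr_sumr.
    rewrite exchange_big /=; apply: ler_sum => g _.
    have [rg|rg] /= := asboolP (below r.+1 (inr g)).
      apply: (@switching _ _ _ _ _ t) => //; last exact: Fb.
      by lra.
    rewrite big1 ?mulr_ge0 ?invr_ge0 ?exprn_ge0 ?(ltW M0) //.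
    by move=> A _; rewrite big1 ?mulr0.
  rewrite sumr_const -[_ *+ #|_|]mulr_natl -/(csize C).
  have : (2 * #|I| * csize C)%:R <= 2 ^+ t :> R by rewrite -natrX ler_nat.
  rewrite !natrM => h.
  rewrite (_ : _ * _ = (2 * #|I|%:R * (csize C)%:R) * 2 ^- t * M); last by ring.
  by rewrite -[leRHS]mul1r ler_wpM2r ?(ltW M0) // ler_pdivrMr ?exprn_gt0 // mul1r.
have {}E : delta * (total_sensitivity (F u))%:R <= M * (X + 1).
  by rewrite -(ler_pM2l M0) mulrA [M * delta]mulrC mulrDr mulr1 mulrDr.
have T0 : 0 <= (total_sensitivity (F u))%:R :> R by [].
(* The factor 128 is 64 from [delta] times 2 from [X + 1 <= 2 * X]. *)
rewrite (_ : _ ^+ j.+1 * _ = 64 * t%:R * (2 * X)); last by rewrite exprS /X; ring.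
have t64 : 0 <= 64 * t%:R :> R by lra.
have := ler_wpM2l t64 E; rewrite [X in X <= _ -> _]mulrA tdelta mul1r => /le_trans; apply.
by rewrite mulrCA ler_wpM2l ?(ltW M0) // ler_wpM2l //; lra.
Qed.

Lemma total_sensitivity_circuit t d o :
  (0 < t)%N -> (2 * #|I| * csize C <= 2 ^ t)%N -> (cdepth C <= d)%N ->
  (total_sensitivity (fun x => ceval C x o))%:R
    <= #|{ffun I -> bool}|%:R * ((128 * t%:R) ^+ d.+1 * t%:R) :> R.
Proof.
move=> t0 tC /cdepth_leP dC.
have -> : total_sensitivity (fun x => ceval C x o) =
    total_sensitivity (fun x => node_value x (output C o)).
  by apply: eq_bigr => x _; apply: eq_card => i; rewrite !inE !ffunE.
apply: (@total_sensitivity_levels t d.+1 0 (fun u x => node_value x u)) => //.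
- by move=> g x; exact: (congr1 (@^~ (inr g)) (node_valueE C x)).
- move=> i x; apply/certifiedP; exists [set i]; first by rewrite cards1.
  by move=> y xy; rewrite (node_valueE C x) (node_valueE C y) /= xy ?inE.
- by move=> u u0 x; have := u0 u [::] isT erefl.
- by move=> w q wq _; rewrite add0n ltnS; exact: dC wq.
Qed.
End CircuitSensitivity.

(** * Random walks on the cube *)

(** Jensen's inequality, from the tangent of [ln] at the mean [m]: the bounds [a x / m - 1] sum to
    0. *)
Lemma sum_ln_le (R : realType) (T : finType) (a : T -> R) : (0 < #|T|)%N ->
  (forall x, 0 < a x) ->
  \sum_x ln (a x) <= #|T|%:R * ln ((\sum_x a x) / #|T|%:R).
Proof.
move=> T0 a0; have T0R : 0 < #|T|%:R :> R by rewrite ltr0n.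
have S0 : 0 < \sum_x a x.
  have /card_gt0P[x _] := T0.
  by rewrite (bigD1 x) //= ltr_pwDl // sumr_ge0 // => y _; rewrite ltW.
set m := _ / _; have m0 : 0 < m by rewrite divr_gt0.
apply: le_trans (_ : \sum_x (ln m + (a x / m - 1)) <= _).
  apply: ler_sum => x _; rewrite -lerBlDl -ln_div ?posrE //.
  have := @le_ln1Dx R (a x / m - 1); rewrite addrCA subrr addr0; apply.
  by rewrite ltrBrDl subrr divr_gt0.
rewrite big_split /= sumr_const big_split /= -mulr_suml sumr_const.
rewrite [in X in _ + (X + _)]/m invf_div mulrCA mulfV ?gt_eqF // mulr1.
by rewrite mulNrn subrr addr0 mulr_natl.
Qed.

(** The logarithm of [4ab <= (a + b)^2]. *)
Lemma ln2_midpoint (R : realType) (a b : R) : 0 < a -> 0 < b ->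
  ln a + ln b + 2 * ln 2 <= 2 * ln (a + b).
Proof.
move=> a0 b0; have ab0 : 0 < a + b by rewrite addr_gt0.
have : ln (a * b * 2 ^+ 2) <= ln ((a + b) ^+ 2).
  rewrite ler_ln ?posrE ?exprn_gt0 ?mulr_gt0 // -subr_ge0.
  by rewrite (_ : _ - _ = (a - b) ^+ 2) ?sqr_ge0 //; ring.
rewrite [X in _ <= X]lnXn // [ln (a * b * _)]lnM ?posrE ?mulr_gt0 ?exprn_gt0 //.
by rewrite [ln (a * b)]lnM ?posrE // lnXn //; lra.
Qed.

Lemma sum_tuple_cons (R : nmodType) (T : finType) n (F : seq T -> R) :
  \sum_(X : n.+1.-tuple T) F X = \sum_b \sum_(X : n.-tuple T) F (b :: X).
Proof.
rewrite pair_bigA /=; pose h (u : T * n.-tuple T) : n.+1.-tuple T := cons_tuple u.1 u.2.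
have hb : bijective h.
  exists (fun X => (thead X, behead_tuple X)) => [[b X]|X].
    by rewrite /h /= theadE; congr pair; exact: val_inj.
  by rewrite [RHS]tuple_eta; exact: val_inj.
by rewrite (reindex h) //; exact: onW_bij.
Qed.

Section Walk.
Variables (R : realType) (p n : nat).
Notation T := (tensor p n).
Implicit Types (J : T) (l : seq (multi_index p n)).

Lemma sum_resample (V : nmodType) (G : T -> V) J i :
  \sum_b G (resample J (i, b)) = G J + G (flip [set i] J).
Proof.
have E b : resample J (i, b) = if b == J i then J else flip [set i] J.
  apply/ffunP => k; rewrite ffunE /=; case: ifP => [/eqP ->|ki].
    by case: ifP => [/eqP //|]; rewrite ffunE inE eqxx; case: b (J i) => [] [].
  by case: ifP => // _; rewrite ffunE inE ki addbF.
by rewrite big_bool !E; case: (J i); rewrite //= addrC.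
Qed.

Lemma sum_flip (V : nmodType) (G : T -> V) i : \sum_J G (flip [set i] J) = \sum_J G J.
Proof. by rewrite [RHS](reindex_inj (inv_inj (@flipK _ [set i]))). Qed.

(** Resampling an entry either keeps or flips it, which preserves the uniform law; so every tensor
    of the path is uniform. *)
Lemma sum_interp (h : T -> R) l t :
  \sum_J \sum_(X : (size l).-tuple bool) h (foldl (@resample p n) J (take t (zip l X)))
    = 2 ^+ size l * \sum_J h J.
Proof.
elim: l t => [|i l IHl] t.
  rewrite expr0 mul1r; apply: eq_bigr => J _.
  rewrite (eq_bigr (fun=> h J)); last by move=> X _; rewrite tuple0; case: t.
  by rewrite sumr_const card_tuple expn0 mulr1n.
case: t => [|t].
  rewrite mulr_sumr; apply: eq_bigr => J _.
  under eq_bigr do rewrite take0 /=.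
  by rewrite sumr_const card_tuple card_bool -[LHS]mulr_natl natrX.
transitivity (\sum_J \sum_b \sum_(X : (size l).-tuple bool)
    h (foldl (@resample p n) (resample J (i, b)) (take t (zip l X)))).
  apply: eq_bigr => J _.
  by rewrite (sum_tuple_cons (size l) (fun X : seq bool =>
    h (foldl (@resample p n) J (take t.+1 (zip (i :: l) X))))).
under eq_bigr do rewrite
  (sum_resample (fun J => \sum_(X : (size l).-tuple bool)
    h (foldl (@resample p n) J (take t (zip l X))))).
rewrite big_split /= (sum_flip
  (fun J => \sum_(X : (size l).-tuple bool) h (foldl (@resample p n) J (take t (zip l X))))).
by rewrite IHl -mulrDl exprS; congr (_ * _); ring.
Qed.

Variable bad : rel T.
Hypothesis bad_irr : irreflexive bad.
Hypothesis bad_sym : symmetric bad.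

Fixpoint avoids J (s : seq (multi_index p n * bool)) : bool :=
  if s is ib :: s' then ~~ bad J (resample J ib) && avoids (resample J ib) s' else true.

Lemma avoidsP J s t : avoids J s -> (t < size s)%N ->
  ~~ bad (foldl (@resample p n) J (take t s)) (foldl (@resample p n) J (take t.+1 s)).
Proof.
elim: s J t => [//|ib s IHs] J [|t] /= /andP[b_J bs] ts.
  by rewrite take0.
exact: IHs bs ts.
Qed.

Definition avoid_count l J : R :=
  \sum_(X : (size l).-tuple bool) (avoids J (zip l X))%:R.

Lemma avoid_count_cons i l J : avoid_count (i :: l) J =
  avoid_count l J + (~~ bad J (flip [set i] J))%:R * avoid_count l (flip [set i] J).
Proof.
rewrite /avoid_count (sum_tuple_cons (size l) (fun X => (avoids J (zip (i :: l) X))%:R)) /=.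
transitivity (\sum_b (~~ bad J (resample J (i, b)))%:R *
    \sum_(X : (size l).-tuple bool) (avoids (resample J (i, b)) (zip l X))%:R : R).
  apply: eq_bigr => b _; rewrite mulr_sumr; apply: eq_bigr => X _.
  by rewrite -natrM mulnb.
rewrite (sum_resample (fun J' => (~~ bad J J')%:R *
    \sum_(X : (size l).-tuple bool) (avoids J' (zip l X))%:R)).
by rewrite bad_irr mul1r.
Qed.

Lemma avoid_count_gt0 l J : 0 < avoid_count l J.
Proof.
elim: l J => [|i l IHl] J.
  rewrite /avoid_count (eq_bigr (fun=> 1)); last by move=> X _; rewrite tuple0.
  by rewrite sumr_const card_tuple.
by rewrite avoid_count_cons ltr_pwDl // mulr_ge0 // ltW.
Qed.

(* A bad step is avoided by staying put, which costs one bit; on the remaining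
   edges concavity of [ln] makes the average over [J] invariant. *)
Lemma sum_ln_avoid_count l :
  ln 2 * ((size l * #|T|)%:R - \sum_(i <- l) \sum_J (bad J (flip [set i] J))%:R)
    <= \sum_J ln (avoid_count l J).
Proof.
elim: l => [|i l IHl].
  rewrite mul0n big_nil subrr mulr0 sumr_ge0 // => J _.
  rewrite /avoid_count (eq_bigr (fun=> 1)); last by move=> X _; rewrite tuple0.
  by rewrite sumr_const card_tuple ln1.
pose L J := ln (avoid_count l J); pose b J : R := (bad J (flip [set i] J))%:R.
have bi J : b (flip [set i] J) = b J by rewrite /b flipK bad_sym.
(* On a bad edge only staying put remains; on a good one [ln2_midpoint] gains [ln 2]. As [b J] is 0
   or 1, one formula covers both cases. *)
have step J : ln 2 * (1 - b J) + (L J + b J * L J + (1 - b J) * L (flip [set i] J)) / 2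
    <= ln (avoid_count (i :: l) J).
  rewrite avoid_count_cons /b; case: (bad _ _); rewrite /= ?mul0r ?mul1r.
    by rewrite addr0 subrr mulr0 mul0r addr0 add0r /L; lra.
  have := ln2_midpoint (avoid_count_gt0 l J) (avoid_count_gt0 l (flip [set i] J)).
  by rewrite -/(L _) -/(L _); lra.
apply: le_trans (ler_sum _ (fun J _ => step J)).
rewrite big_split -mulr_sumr -mulr_suml !big_split /= sumrN sumr_const.
(* Since [b] is invariant under the flip, reindexing undoes the flip, and the terms in [b J * L J]
   cancel. *)
have -> : \sum_J (1 - b J) * L (flip [set i] J) = \sum_J (1 - b J) * L J.
  rewrite -(sum_flip (fun J => (1 - b J) * L J) i).
  by apply: eq_bigr => J _; rewrite bi.
have -> : \sum_J (1 - b J) * L J = \sum_J L J - \sum_J b J * L J.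
  by rewrite -sumrB; apply: eq_bigr => J _; rewrite mulrBl mul1r.
rewrite big_cons mulSn natrD -/L.
by move: IHl; rewrite -/L -/b; set x := \sum_J b J; lra.
Qed.

(** Jensen's inequality turns the bound on the mean logarithm into one on the mean number of
    avoiding sign sequences. *)
Lemma sum_avoid_count l :
  expR (- (ln 2 * ((\sum_(i <- l) \sum_J (bad J (flip [set i] J))%:R) / #|T|%:R)))
    * (2 ^+ size l * #|T|%:R) <= \sum_J avoid_count l J.
Proof.
have T0 : (0 < #|T|)%N by apply/card_gt0P; exists [ffun=> true].
have T0R : 0 < #|T|%:R :> R by rewrite ltr0n.
have := sum_ln_le T0 (avoid_count_gt0 l); have := sum_ln_avoid_count l.
set S := \sum_J avoid_count l J; set B := \sum_(i <- l) _.
have S0 : 0 < S.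
  have /card_gt0P[J _] := T0.
  by rewrite /S (bigD1 J) //= ltr_pwDl ?avoid_count_gt0 // sumr_ge0 // => y _;
  rewrite ltW // avoid_count_gt0.
move=> /le_trans/[apply]; rewrite -ler_pdivrMl // => h.
rewrite mulrA -ler_pdivlMr //.
have <- : expR (ln (S / #|T|%:R)) = S / #|T|%:R by rewrite lnK // posrE divr_gt0.
have <- : expR (ln (2 ^+ size l)) = 2 ^+ size l :> R by rewrite lnK // posrE exprn_gt0.
rewrite -expRD ler_expR lnXn //.
apply: le_trans h; rewrite natrM -[_ *+ size l]mulr_natl.
by rewrite le_eqVlt; apply/predU1P; left; field; lra.
Qed.

End Walk.

(** * The interpolation path *)

Lemma natr_card (R : pzSemiRingType) (T : finType) (P : pred T) :
  #|[pred x | P x]|%:R = \sum_x (P x)%:R :> R.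
Proof.
rewrite -sum1_card natr_sum big_mkcond /=; apply: eq_bigr => x _.
by rewrite inE; case: (P x).
Qed.

Section PathSpace.
Variables (R : realType) (p n : nat).
Notation T := (tensor p n).

(** The ordering is summed outermost and the tuple length becomes its size, so that results on a
    fixed list apply. *)
Lemma sum_path_space (F : T -> seq (multi_index p n) -> seq bool -> R) :
  \sum_(w : path_space p n) F w.1.1 (val w.1.2) w.2 =
  \sum_(o : ordering p n) \sum_J
    \sum_(X : (size (val o)).-tuple bool) F J (val o) X.
Proof.
transitivity (\sum_(u : T * ordering p n) \sum_(X : (n ^ p).-tuple bool) F u.1 (val u.2) X).
  by rewrite pair_bigA.
rewrite -(pair_bigA _ (fun (J : T) (o : ordering p n) =>
  \sum_(X : (n ^ p).-tuple bool) F J (val o) X)) /=.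
rewrite exchange_big /=; apply: eq_bigr => o _; apply: eq_bigr => J _.
have E l m : size l = m -> \sum_(X : m.-tuple bool) F J l X =
    \sum_(X : (size l).-tuple bool) F J l X by move=> <-.
by apply: E; rewrite size_tuple.
Qed.

Lemma sum_ordering_const (x : R) :
  \sum_(o : ordering p n) x = #|{: ordering p n}|%:R * x.
Proof. by rewrite sumr_const mulr_natl. Qed.

Lemma card_path_space :
  #|path_space p n|%:R = #|{: ordering p n}|%:R * (2 ^+ (n ^ p) * #|T|%:R) :> R.
Proof.
by rewrite !card_prod card_tuple card_bool !natrM natrX; ring.
Qed.

Lemma card_interp (E : pred T) t :
  #|[pred w : path_space p n | E (interp w t)]|%:R =
  #|{: ordering p n}|%:R * (2 ^+ (n ^ p) * #|E|%:R) :> R.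
Proof.
rewrite natr_card.
transitivity (\sum_(w : path_space p n)
    (E (foldl (@resample p n) w.1.1 (take t (zip (val (val w.1.2)) w.2))))%:R : R).
  by apply: eq_bigr => -[[J o] X].
rewrite (sum_path_space (fun J l X => (E (foldl (@resample p n) J (take t (zip l X))))%:R)).
rewrite -sum_ordering_const; apply: eq_bigr => o _.
rewrite (sum_interp (fun J => (E J)%:R)) size_tuple; congr (_ * _).
by rewrite -natr_card.
Qed.

Lemma card_avoids (bad : rel T) (B : R) : irreflexive bad -> symmetric bad ->
  \sum_i \sum_J (bad J (flip [set i] J))%:R <= #|T|%:R * B ->
  expR (- (ln 2 * B)) * #|path_space p n|%:R <=
  #|[pred w : path_space p n | avoids bad w.1.1 (zip (val (val w.1.2)) w.2)]|%:R.
Proof.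
move=> bi bs bB; rewrite natr_card.
rewrite (sum_path_space (fun J l X => (avoids bad J (zip l X))%:R)).
rewrite card_path_space mulrCA -sum_ordering_const; apply: ler_sum => o _.
have T0 : 0 < #|T|%:R :> R by rewrite ltr0n; apply/card_gt0P; exists [ffun=> true].
apply: le_trans (sum_avoid_count R bi bs (val o)); rewrite size_tuple.
apply: ler_wpM2r; first by rewrite mulr_ge0 // exprn_ge0.
rewrite ler_expR lerN2; apply: ler_wpM2l; first by rewrite ln_ge0 // ler1n.
rewrite ler_pdivrMr // mulrC; apply: le_trans bB.
(* An ordering has no repetition, so its bad edges are among those counted in [bB]. *)
rewrite big_uniq ?(valP o) //= [leRHS](bigID (mem (val o))) /= lerDl.
by apply: sumr_ge0 => i _; apply: sumr_ge0.
Qed.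

End PathSpace.

(** * Overlaps of outputs and the gap along the path *)

Section Outputs.
Variables (R : realType) (n : nat).
Implicit Types (s : spins n).

Definition dist s s' : nat := #|[set i | s i != s' i]|.

Lemma distss s : dist s s = 0%N.
Proof. by apply: eq_card0 => i; rewrite inE eqxx. Qed.

Lemma distC s s' : dist s s' = dist s' s.
Proof. by apply: eq_card => i; rewrite !inE eq_sym. Qed.

Lemma overlapss s : overlap R s s = n%:R.
Proof.
rewrite /overlap (eq_bigr (fun=> 1)) ?sumr_const ?card_ord //.
by move=> i _; rewrite /sgn; case: (s i); rewrite ?mulr1 // mulrNN mulr1.
Qed.

Lemma overlap_dist s s1 s2 :
  `|overlap R s s1 - overlap R s s2| <= 2 * (dist s1 s2)%:R.
Proof.
rewrite /overlap -sumrB /dist -sum1_card natr_sum mulr_sumr [leRHS]big_mkcond.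
apply: le_trans (ler_norm_sum _ _ _) _; apply: ler_sum => i _.
rewrite inE /sgn.
by case: (s i) (s1 i) (s2 i) => [] [] [] /=; rewrite ler_norml; lra.
Qed.

(** Double counting of the triples (direction, input, output) at which the output changes. *)
Lemma sum_dist_flip (V : finType) (c : {ffun V -> bool} -> spins n) :
  (\sum_i \sum_x dist (c x) (c (flip [set i] x)) =
   \sum_o total_sensitivity (fun x => c x o))%N.
Proof.
rewrite exchange_big [RHS]exchange_big; apply: eq_bigr => x _ /=.
transitivity (\sum_i \sum_o (c x o != c (flip [set i] x) o : nat))%N.
  by apply: eq_bigr => i _; rewrite /dist -sum1dep_card big_mkcond;
  apply: eq_bigr => o _; case: (_ == _).
rewrite exchange_big; apply: eq_bigr => o _; rewrite -sum1dep_card [RHS]big_mkcond.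
by apply: eq_bigr => i _; rewrite eq_sym; case: (_ == _).
Qed.

End Outputs.

(** The normalized overlap with the initial output starts at 1, and a step without a jump changes it
    by less than [nu2 - nu1]. To fall below [nu2] it would have to land in the gap, so it stays at
    least [nu2], whereas the event forces at most [nu1] at the final time. *)
Lemma ogp_avoids_false (R : realType) (p n : nat) (eta nu1 nu2 : R)
    (c : tensor p n -> spins n) (w : path_space p n) :
  (0 < n)%N -> nu1 < nu2 < 1 -> ogp_event eta nu1 nu2 w ->
  (forall t, (t <= n ^ p)%N ->
     eta * scale R p n <= energy R (interp w t) (c (interp w t))) ->
  avoids (fun J J' => (nu2 - nu1) * n%:R <= 2 * (dist (c J) (c J'))%:R :> R)
    w.1.1 (zip (val (val w.1.2)) w.2) -> False.
Proof.
move=> n0 /andP[nu12 nu2_1] ogp Et av.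
have n0R : 0 < n%:R :> R by rewrite ltr0n.
pose q t := `|overlap R (c (interp w 0)) (c (interp w t))| / n%:R.
have ogpt t (tN : (t <= n ^ p)%N) := ogp 0%N t _ _ (leq0n t) tN (Et _ (leq0n _)) (Et t tN).
have q_ge t : (t <= n ^ p)%N -> nu2 <= q t.
  elim: t => [_|t IHt tN]; first by rewrite /q overlapss ger0_norm // divff ?gt_eqF // ltW.
  have {}IHt := IHt (ltnW tN); have [nq _] := ogpt _ tN.
  rewrite leNgt; apply/negP => q2; apply: nq; rewrite q2 andbT -/(q _).
  have ts : (t < size (zip (val (val w.1.2)) w.2))%N by rewrite size_zip !size_tuple minnn.
  have := avoidsP av ts; have wE k : foldl (@resample p n) w.1.1
      (take k (zip (val (val w.1.2)) w.2)) = interp w k by case: (w) => [[? ?] ?].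
  rewrite !wE -ltNge => d.
  have := overlap_dist R (c (interp w 0)) (c (interp w t)) (c (interp w t.+1)).
  move=> /(le_trans (lerB_dist _ _)) /le_lt_trans/(_ d).
  rewrite -ltr_pdivrMr // mulrBl -/(q t) -/(q _); lra.
have [_ /(_ erefl erefl)] := ogpt _ (leqnn _).
by rewrite -/(q _) leNgt (lt_le_trans nu12) // q_ge.
Qed.

(* A circuit of the family maps typical tensors to spins above the OGP level,
   so a walk whose outputs never jump must leave the OGP event or meet an
   atypical tensor. *)
Lemma ogp_circuit_bound (R : realType) (p n sz dp : nat)
    (eta_star eps nu1 nu2 rho B : R) (C : circuit (multi_index p n) 'I_n) :
  (0 < n)%N -> nu1 < nu2 < 1 -> 0 <= rho -> 0 <= eta_star - eps ->
  in_circuit_family sz dp rho C ->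
  (forall o, (total_sensitivity (fun x => ceval C x o))%:R <= #|tensor p n|%:R * B) ->
  expR (- (ln 2 * (2 / (nu2 - nu1) * B))) * #|path_space p n|%:R <=
    #|[pred w : path_space p n | ~~ `[< ogp_event (rho * (eta_star - eps)) nu1 nu2 w >] ]|%:R +
    (n ^ p).+1%:R * (#|path_space p n|%:R *
      Pr R (fun J : tensor p n => eps <= `|eta_n R J - eta_star|)).
Proof.
move=> n0 nu rho0 eps_le [_ _ Crho] CB; have /andP[nu12 _] := nu.
set eta := rho * _.
have n0R : 0 < n%:R :> R by rewrite ltr0n.
pose c J := ceval C J.
pose bad : rel (tensor p n) := fun J J' =>
  (nu2 - nu1) * n%:R <= 2 * (dist (c J) (c J'))%:R.
have bi : irreflexive bad.
  by move=> J; rewrite /bad distss mulr0; apply/negbTE; rewrite -ltNge mulr_gt0 // subr_gt0.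
have bs : symmetric bad by move=> J J'; rewrite /bad distC.
(* Markov's inequality: a bad edge has [2 * dist >= (nu2 - nu1) * n], and the distances add up to
   the total sensitivities of the [n] outputs; the factors [n] cancel. *)
have bB : \sum_i \sum_J (bad J (flip [set i] J))%:R
    <= #|tensor p n|%:R * (2 / (nu2 - nu1) * B).
  have D0 : 0 < (nu2 - nu1) * n%:R by rewrite mulr_gt0 // subr_gt0.
  rewrite -(ler_pM2l D0).
  apply: le_trans (_ : 2 * (\sum_i \sum_J dist (c J) (c (flip [set i] J)))%:R <= _).
    rewrite natr_sum !mulr_sumr; apply: ler_sum => i _.
    rewrite natr_sum !mulr_sumr; apply: ler_sum => J _.
    by have [|_] := boolP (bad _ _); rewrite ?mulr1 // mulr0 mulr_ge0.
  rewrite sum_dist_flip natr_sum.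
  apply: le_trans (_ : 2 * (n%:R * (#|tensor p n|%:R * B)) <= _).
    apply: ler_wpM2l => //; rewrite -[n in n%:R]card_ord mulr_natl -sumr_const.
    by apply: ler_sum => o _; exact: CB.
  rewrite le_eqVlt; apply/predU1P; left; field.
  by rewrite subr_eq0 gt_eqF.
apply: le_trans (card_avoids bi bs bB) _.
pose E : pred (tensor p n) := fun J => `[< eps <= `|eta_n R J - eta_star| >].
have PrE : #|tensor p n|%:R * Pr R (fun J : tensor p n => eps <= `|eta_n R J - eta_star|)
    = #|E|%:R.
  rewrite /Pr mulrCA mulfV ?mulr1; first by congr (_%:R); apply: eq_card.
  by rewrite pnatr_eq0 -lt0n; apply/card_gt0P; exists [ffun=> true].
have -> : #|path_space p n|%:R *
      Pr R (fun J : tensor p n => eps <= `|eta_n R J - eta_star|) =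
    #|{: ordering p n}|%:R * (2 ^+ (n ^ p) * #|E|%:R).
  by rewrite card_path_space -PrE; ring.
(* Each [interp w t] is uniform, so this term is a union bound over the [n ^ p + 1] times. *)
have -> : (n ^ p).+1%:R * (#|{: ordering p n}|%:R * (2 ^+ (n ^ p) * #|E|%:R)) =
    \sum_(t < (n ^ p).+1) \sum_(w : path_space p n) (E (interp w t))%:R :> R.
  rewrite -[(n ^ p).+1 in LHS]card_ord mulr_natl -sumr_const.
  by apply: eq_bigr => t _; rewrite -(card_interp _ E t) natr_card.
rewrite exchange_big !natr_card -big_split /=; apply: ler_sum => w _.
have S0 : 0 <= \sum_(t < (n ^ p).+1) (E (interp w t))%:R :> R by apply: sumr_ge0.
have [av|_] := boolP (avoids _ _ _); last by rewrite addr_ge0.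
have [ogp|_] := boolP `[< _ >]; last by rewrite lerDl.
rewrite add0r; have [/existsP[t Et]|/existsPn nE] :=
    boolP [exists t : 'I_(n ^ p).+1, E (interp w t)].
  by rewrite (bigD1 t) //= Et lerDl; apply: sumr_ge0.
exfalso; apply: (@ogp_avoids_false R p n eta nu1 nu2 c w n0 nu _ _ av).
  exact/asboolP.
(* All tensors of the path are typical here; their maxima are then nonnegative, so the guarantee of
   the family applies. *)
move=> t tN; have := nE (Ordinal (n := (n ^ p).+1) (m := t) tN).
rewrite /E /=; set J := interp w t => /asboolPn/negP; rewrite -ltNge ltr_norml => /andP[+ _].
have sc0 : 0 < scale R p n by rewrite powR_gt0.
rewrite /eta_n ltrBrDl => h.
have {}h : (eta_star - eps) * scale R p n <= max_energy R J.
  by rewrite -ler_pdivlMr // mulrC ltW.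
have J0 : 0 <= max_energy R J by apply: le_trans h; rewrite mulr_ge0 // ltW.
apply: le_trans (Crho J J0).
by rewrite /eta -mulrA ler_wpM2l.
Qed.

(** * Asymptotic estimates in [u = ln n] *)

(** The bound is [n^(3/4)]. From [d ln u < u/2], [ln K <= (ln u)/4] and [ln u <= u/32], the exponent
    [(d + 2)(ln K + ln u)] is at most [5u/8 + 5u/64 < 3u/4]. *)
Lemma polylog_le_exp (R : realType) (K : R) : 1 <= K ->
  exists M : R, forall (u : R) (d : nat), M <= u -> d%:R < u / (2 * ln u) ->
    (K * u) ^+ d.+2 <= expR (3 / 4 * u).
Proof.
move=> K1; exists (4096 + expR (4 * ln K + 1)) => u d Mu.
have k0 : 0 <= ln K by rewrite ln_ge0.
have e0 := expR_gt0 (4 * ln K + 1).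
have u0 : 0 < u by lra.
have vk : 4 * ln K + 1 <= ln u.
  by rewrite -[leLHS]expRK ler_ln ?posrE ?expR_gt0 //; lra.
have vu : ln u <= u / 32.
  have -> : u = 64 * (u / 64) by field.
  have u64 : 0 < u / 64 by lra.
  rewrite lnM ?posrE //.
  have := @ln_sublinear R 64 (ltr0Sn _ _); have := ln_sublinear u64; lra.
rewrite ltr_pdivlMr; last lra.
move=> du; have d0 : 0 <= d%:R :> R by [].
have K0 : 0 < K by lra.
rewrite -[leLHS]lnK ?posrE ?exprn_gt0 ?mulr_gt0 // ler_expR lnXn ?mulr_gt0 //.
rewrite lnM ?posrE // -[_ *+ d.+2]mulr_natl -[d.+2]addn2 natrD; nra.
Qed.

Lemma exp_decay (R : realType) (p : nat) (g c : R) : 0 < g -> 0 <= c ->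
  exists M : R, forall u : R, M <= u ->
    (expR u ^+ p + 2) * expR (- g * expR u) < expR (- (c * expR (3 / 4 * u))).
Proof.
move=> g0 c0; have p0 : 0 <= p%:R :> R by [].
(* In [a], the summand [c] pays for the right-hand side and [2p + 3] for the prefactor, which is at
   most [exp (2 + pu)]. *)
pose a := c + 2 * p%:R + 3; have a0 : 0 < a by rewrite /a; lra.
exists (4 * a / g) => u Mu.
have u0 : 0 <= u by apply: le_trans Mu; rewrite divr_ge0 ?mulr_ge0 // ltW.
have gu : a <= g * expR (u / 4).
  have := expR_ge1Dx (u / 4); rewrite ler_pdivrMr // in Mu => h.
  have : g * (1 + u / 4) <= g * expR (u / 4) by rewrite ler_pM2l.
  by nra.
have E3 := expR_ge1Dx (3 / 4 * u).
have E : a * expR (3 / 4 * u) <= g * expR u.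
  have -> : expR u = expR (u / 4) * expR (3 / 4 * u) by rewrite -expRD; congr expR; field.
  by rewrite mulrA ler_wpM2r ?expR_ge0.
have h : expR u ^+ p + 2 <= expR (2 + p%:R * u).
  rewrite expRD expRM_natl; have e2 : 3 <= expR 2 :> R.
    by have := expR_ge1Dx (2 : R); lra.
  have : 1 <= expR u ^+ p.
    by rewrite exprn_ege1 // -[leLHS]expR0 ler_expR.
  by nra.
apply: le_lt_trans (_ : expR (2 + p%:R * u) * expR (- g * expR u) < _).
  by rewrite ler_wpM2r ?expR_ge0.
rewrite -expRD ltr_expR; rewrite /a in E; nra.
Qed.

Lemma ln2_ge_half (R : realType) : 1 / 2 <= ln 2 :> R.
Proof.
have := @le_ln1Dx R (- (1 / 2)); rewrite (_ : 1 + - (1 / 2) = 2^-1); last by field.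
have h : -1 < - (1 / 2) :> R by lra.
by rewrite lnV ?posrE // => /(_ h); lra.
Qed.

(** With [t] the rounded logarithm, [2^(t - 1) < 2 n^(p + alpha)] and [ln 2 >= 1/2] give
    [t <= 2 + 2(p + alpha) ln n]; [ln n >= 1] absorbs the constant. *)
Lemma up_log_size_le (R : realType) (n p s : nat) (alpha : R) :
  (1 < 2 * n ^ p * s)%N -> 0 <= alpha -> 1 <= ln n%:R :> R ->
  s%:R <= n%:R `^ alpha ->
  128 * (up_log 2 (2 * n ^ p * s))%:R <= 256 * (1 + p%:R + alpha) * ln n%:R :> R.
Proof.
set m := (_ * s)%N => m1 alpha0; set u := ln _ => u1 sn.
have n0R : 0 < n%:R :> R by rewrite ltNge; apply/negP => /ln0; rewrite -/u; lra.
have t0 : (0 < up_log 2 m)%N by rewrite up_log_gt0.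
have : (2 ^ (up_log 2 m).-1 < m)%N by apply: up_log_gtn.
rewrite -(ltr_nat R) natrX /m !natrM natrX -/m => h.
have {h} : ln (2 ^+ (up_log 2 m).-1) <= ln (2 * n%:R ^+ p * n%:R `^ alpha) :> R.
  rewrite ler_ln ?posrE ?exprn_gt0 ?mulr_gt0 ?exprn_gt0 ?powR_gt0 //.
  by apply: le_trans (ltW h) _; rewrite ler_wpM2l ?mulr_ge0 ?exprn_ge0.
rewrite !lnM ?posrE ?mulr_gt0 ?exprn_gt0 ?powR_gt0 // !lnXn // ln_powR -/u.
rewrite -[ln 2 *+ _]mulr_natl -[u *+ _]mulr_natl.
have -> : (up_log 2 m)%:R = (up_log 2 m).-1%:R + 1 :> R by rewrite natr1 prednK.
set t : R := _.-1%:R => h; have l2 := ln2_ge_half R.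
have pu : 0 <= (p%:R + alpha) * u by rewrite mulr_ge0 ?addr_ge0 //; lra.
suff : t - 1 <= 2 * ((p%:R + alpha) * u).
  have -> : 256 * (1 + p%:R + alpha) * u = 256 * u + 256 * ((p%:R + alpha) * u) by ring.
  by lra.
have [t1|t1] := leP t 1; first by lra.
have : (t - 1) * (1 / 2) <= (t - 1) * ln 2 by rewrite ler_wpM2l //; lra.
by lra.
Qed.

(** * Choice of constants and conclusion *)

Local Open Scope classical_set_scope.

Theorem theorem3 (R : realType) (p : nat) (eta_star eta_OGP nu1 nu2 g : R)
    (alpha rho : R) (s d : nat -> nat)
    (p_ge4 : (4 <= p)%N) (p_even : ~~ odd p)
    (eta_starP : is_eta_star p eta_star)
    (eta_OGP_bounds : 0 < eta_OGP < eta_star)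
    (nu_bounds : [/\ 0 < nu1, nu1 < nu2 & nu2 < 1])
    (g_gt0 : 0 < g)
    (OGP : ensemble_OGP p eta_OGP nu1 nu2 g)
    (alpha_gt0 : 0 < alpha)
    (rho_bounds : eta_OGP / eta_star < rho < 1)
    (s_gt0 : forall n, (0 < s n)%N) (d_gt0 : forall n, (0 < d n)%N) :
  \forall n \near \oo,
    [\/ ~ exists C : circuit (multi_index p n) 'I_n,
            in_circuit_family (s n) (d n) rho C,
        n%:R `^ alpha <= (s n)%:R :> R
      | ln n%:R / (2 * ln (ln n%:R)) <= (d n)%:R :> R].
Proof.
have [eta_star0 conc] := eta_starP.
have /andP[eta0 eta_lt] := eta_OGP_bounds; have /andP[rho_gt _] := rho_bounds.
have [nu1_0 nu12 nu2_1] := nu_bounds.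
have rho0 : 0 < rho by apply: lt_trans rho_gt; rewrite divr_gt0.
(* Chosen so that [rho * (eta_star - eps) = eta_OGP]: on typical tensors the circuit reaches the OGP
   level. *)
pose eps := eta_star - eta_OGP / rho.
have epsE : eta_star - eps = eta_OGP / rho by rewrite /eps; ring.
have eps0 : 0 < eps.
  by rewrite subr_gt0 ltr_pdivrMr // mulrC -ltr_pdivrMr.
have [g' g'0 concg'] := conc eps eps0.
(* A common rate for both failure probabilities. *)
pose g0 := Num.min g g'; have g0_gt0 : 0 < g0 by rewrite lt_min g_gt0.
pose K := 256 * (1 + p%:R + alpha).
have p0 : 0 <= p%:R :> R by [].
have K1 : 1 <= K by rewrite /K; lra.
have [M1 HM1] := polylog_le_exp K1.
pose c := ln 2 * (2 / (nu2 - nu1)).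
have c0 : 0 <= c by rewrite mulr_ge0 ?ln_ge0 ?ler1n // divr_ge0 // subr_ge0 ltW.
have [M2 HM2] := exp_decay p g0_gt0 c0.
have large := nbhs_infty_ger (expR (Num.max 1 (Num.max M1 M2))).
apply: filterS (filterI OGP (filterI concg' large)) => n [ogp_n [conc_n nM]].
have n0R : 0 < n%:R :> R by apply: lt_le_trans nM; exact: expR_gt0.
have n0 : (0 < n)%N by rewrite -(ltr0n R).
pose u := ln (n%:R : R); have nE : expR u = n%:R by rewrite lnK.
have : Num.max 1 (Num.max M1 M2) <= u by rewrite -ler_expR nE.
rewrite !ge_max => /and3P[u1 uM1 uM2].
have [[C Cfam]|] := pselect (exists C : circuit (multi_index p n) 'I_n,
  in_circuit_family (s n) (d n) rho C); last by move=> ?; apply: Or31.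
have [|sn] := leP (n%:R `^ alpha) ((s n)%:R : R); first by move=> ?; apply: Or32.
have [|dn] := leP (ln n%:R / (2 * ln (ln n%:R))) ((d n)%:R : R); first by move=> ?; apply: Or33.
exfalso.
have [Cs Cd _] := Cfam.
pose m := (2 * n ^ p * s n)%N.
have m1 : (1 < m)%N.
  by rewrite /m -mulnA (@leq_trans (2 * 1)) // leq_mul2l muln_gt0 expn_gt0 n0 s_gt0.
pose t := up_log 2 m.
have t0 : (0 < t)%N by rewrite up_log_gt0.
have tm : (2 * #|{: multi_index p n}| * csize C <= 2 ^ t)%N.
  apply: leq_trans (up_logP m _) => //.
  by rewrite /m card_ffun !card_ord leq_mul2l Cs orbT.
have tu : 128 * t%:R <= K * u by apply: up_log_size_le; rewrite // ltW.
pose B := expR (3 / 4 * u).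
have CB o : (total_sensitivity (fun x => ceval C x o))%:R <= #|tensor p n|%:R * B.
  apply: le_trans (total_sensitivity_circuit R o t0 tm Cd) _.
  apply: ler_wpM2l => //; apply: le_trans (HM1 u _ uM1 dn).
  have tR : 0 <= t%:R :> R by [].
  (* The last factor [t] is enlarged to [128 * t], giving a pure power. *)
  apply: le_trans (_ : (128 * t%:R) ^+ (d n).+2 <= _).
    by rewrite [leRHS]exprSr ler_wpM2l ?exprn_ge0 ?mulr_ge0 // ler_peMl // ler1n.
  have tR128 : 0 <= 128 * t%:R :> R by rewrite mulr_ge0.
  by rewrite lerXn2r ?nnegrE // (le_trans tR128).
have nu : nu1 < nu2 < 1 by rewrite nu12.
have eta0' : 0 <= eta_star - eps by rewrite epsE divr_ge0 // ltW.
have := ogp_circuit_bound n0 nu (ltW rho0) eta0' Cfam CB.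
have -> : rho * (eta_star - eps) = eta_OGP by rewrite epsE mulrC divfK ?gt_eqF.
set Om := #|path_space p n|%:R; set Q := #|_|%:R.
(* Were the path space empty, [Pr] would be 0 by the convention on division, against the positive
   lower bound [1 - expR (- g * n)]. *)
have Om0 : 0 < Om.
  rewrite lt_neqAle ler0n andbT eq_sym; apply/eqP => Om0.
  move: ogp_n; rewrite /Pr -/Om Om0 invr0 mulr0 subr_le0 -[leLHS]expR0 ler_expR.
  by rewrite leNgt mulNr oppr_lt0 mulr_gt0.
have QE : Q <= expR (- g * n%:R) * Om.
  move: ogp_n; rewrite /Pr ler_pdivlMr // mulrBl mul1r lerBlDl -lerBlDr.
  apply: le_trans; rewrite lerBrDr /Q /Om -natrD
    -(cardC [pred w | `[< ogp_event eta_OGP nu1 nu2 w >]]).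
  by rewrite ler_nat addnC.
apply/negP; rewrite -ltNge.
have gn : expR (- g * n%:R) <= expR (- g0 * n%:R).
  by rewrite ler_expR ler_wpM2r // lerN2 ge_min lexx.
have g'n : expR (- g' * n%:R) <= expR (- g0 * n%:R).
  by rewrite ler_expR ler_wpM2r // lerN2 ge_min lexx orbT.
have := HM2 u uM2; rewrite nE -/B => h.
(* One OGP failure and [n ^ p + 1] atypical times give the factor [n ^ p + 2] of [exp_decay]. *)
apply: le_lt_trans (_ : expR (- g0 * n%:R) * Om +
  (n ^ p).+1%:R * (Om * expR (- g0 * n%:R)) < _).
  apply: lerD; first by apply: le_trans QE _; rewrite ler_wpM2r // ltW.
  by rewrite ler_wpM2l // ler_wpM2l ?(ltW Om0) //; apply: le_trans conc_n g'n.
have -> : ln 2 * (2 / (nu2 - nu1) * B) = c * B by rewrite /c mulrA.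
rewrite (_ : _ + _ = (n%:R ^+ p + 2) * expR (- g0 * n%:R) * Om).
  by rewrite ltr_pM2r.
by rewrite -natr1 natrX; ring.
Qed.
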